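(* Let $k \geq 2$ be an integer and set $m = 3+k$. Then the triple \[ \left(\mathrm{Inc}_{\mathrm{Packed}}^{3+k}(3 \times k),\ \langle \mathrm{KPro}\rangle,\ f^{(2^3, 1^{k-2})}(q)\right) \] exhibits the cyclic sieving phenomenon, and $\mathrm{KPro}^{3+k}$ is the identity map on $\mathrm{Inc}_{\mathrm{Packed}}^{3+k}(3 \times k)$.
   Context: An increasing tableau of shape $\lambda$ (an integer partition) is a filling of the Young diagram of $\lambda$ with positive integers strictly increasing from left to right along rows and from top to bottom down columns. $\mathrm{Inc}^m(\lambda)$ is the set of increasing tableaux of shape $\lambda$ with all entries at most $m$. A tableau $T$ is packed if every value $1,2,\ldots,\max(T)$ appears in $T$; $\mathrm{Inc}_{\mathrm{Packed}}^m(\lambda)$ is the set of packed increasing tableaux of shape $\lambda$ with maximum entry exactly $m$. $a \times b$ denotes the rectangular partition $(b^a)$ ($a$ rows of length $b$); $(2^3,1^{k-2})$ is the partition with three parts equal to $2$ followed by $k-2$ parts equal to $1$. K-promotion $\mathrm{KPro}$ on $\mathrm{Inc}^m(\lambda)$: given $T$, delete the entry $1$ (if present), leaving empty cells. The southeast neighbors of a cell are the (at most two) cells immediately to its right and immediately below it. Repeatedly, simultaneously for all empty cells, do the following until no empty cell has a southeast neighbor: label each empty cell by the minimal label among its southeast neighbors, and remove that label from each southeast neighbor in which it appears (those become empty); an empty cell with no southeast neighbors stays unchanged. Finally label all empty cells by $m+1$ and subtract $1$ from every label; the result is $\mathrm{KPro}(T)$. It preserves $\mathrm{Inc}_{\mathrm{Packed}}^m(\lambda)$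 in the present setting. Cyclic sieving phenomenon: for a finite set $X$ with an action of a finite cyclic group $C$ and $f(q)\in\mathbb{Z}_{\geq0}[q]$, the triple $(X,C,f(q))$ exhibits the CSP if for every $\sigma\in C$ of order $d$, the number of $x\in X$ fixed by $\sigma$ equals $f(e^{2\pi i/d})$. $q$-hook formula: for a partition $\lambda$ with $N$ cells, $f^\lambda(q) = [N]_q!/\prod_{c\in\lambda}[h_c]_q$, where $h_c$ is the hook length of cell $c$ (number of cells weakly right of $c$ in its row plus cells strictly below $c$ in its column), $[d]_q = (1-q^d)/(1-q)$, and $[N]_q! = [N]_q[N-1]_q\cdots[1]_q$. *)

(* Defs.v *)
From mathcomp Require Import all_boot all_order all_fingroup all_algebra all_solvable.
From mathcomp Require Import reals trigo.
From mathcomp Require Import complex.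

Set Implicit Arguments.
Unset Strict Implicit.
Unset Printing Implicit Defensive.

Import GRing.Theory Num.Theory.
Local Open Scope ring_scope.

(* An integer partition is given by the sequence of its parts in weakly
   decreasing order.  Rows and columns are numbered from 0, row 0 at the top. *)
Section Diagrams.
Variable lam : seq nat.

Definition cell : finType := {i : 'I_(size lam) & 'I_(nth 0%N lam i)}.

Definition crow (c : cell) : nat := tag c.
Definition ccol (c : cell) : nat := tagged c.

Definition se_nbr (c d : cell) : bool :=
  ((crow d == crow c) && (ccol d == (ccol c).+1))
  || ((crow d == (crow c).+1) && (ccol d == ccol c)).

Definition hook_length (c : cell) : nat :=
  (#|[set d : cell | (crow d == crow c) && (ccol c <= ccol d)]|
   + #|[set d : cell | (ccol d == ccol c) && (crow c < crow d)]|)%N.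

End Diagrams.

Definition rect (a b : nat) : seq nat := nseq a b.

Section Tableaux.
Variables (lam : seq nat) (m : nat).

Definition filling : finType := {ffun cell lam -> 'I_m.+1}.

Implicit Type T : filling.

Definition increasing T : bool :=
  [&& [forall c, (0 < T c)%N],
      [forall c, forall d,
        (crow c == crow d) && (ccol c < ccol d)%N ==> (T c < T d)%N]
    & [forall c, forall d,
        (ccol c == ccol d) && (crow c < crow d)%N ==> (T c < T d)%N]].

Definition max_entry T : nat := \max_c T c.

Definition packed T : bool :=
  all (fun v => [exists c, T c == v :> nat]) (iota 1 (max_entry T)).

Definition inc_packed : finType :=
  {T : filling | [&& increasing T, packed T & max_entry T == m]}.

(* During a slide, a cell is [None] when empty and [Some v] when labelled v. *)
Definition partial_filling := cell lam -> option nat.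

Definition min_seq (s : seq nat) : option nat :=
  if s is v :: s' then Some (foldr minn v s') else None.

Definition min_se_label (U : partial_filling) (c : cell lam) : option nat :=
  min_seq (pmap U [seq d <- enum (cell lam) | se_nbr c d]).

Definition slide (U : partial_filling) : partial_filling := fun c =>
  if U c is Some v then
    if [exists b, [&& U b == None, se_nbr b c & min_se_label U b == Some v]]
    then None else Some v
  else min_se_label U c.

Definition delete_ones T : partial_filling := fun c =>
  if T c == 1%N :> nat then None else Some (T c : nat).

(* On an increasing tableau of partition shape, the empty cells that still
   have southeast neighbors after t slides all lie at distance t from the
   corner, so none is left after #|cell lam| slides.  A partial filling in
   which no empty cell has a southeast neighbor is fixed by [slide], hence
   the extra slides change nothing. *)
Definition slide_all (U : partial_filling) : partial_filling :=
  iter #|cell lam| slide U.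

(* Labels occurring in a slide are at most m, so [inord] never truncates. *)
Definition KPro T : filling :=
  [ffun c => inord (odflt m.+1 (slide_all (delete_ones T) c)).-1].

End Tableaux.

Definition qint (d : nat) : {poly int} := \sum_(i < d) 'X^i.

Lemma qintE d : qint d * (1 - 'X) = 1 - 'X^d.
Proof. by rewrite mulrC -[LHS]opprK -mulNr !opprB -subrX1 opprB. Qed.

Definition qfact (n : nat) : {poly int} := \prod_(1 <= d < n.+1) qint d.

Definition qhook_den (lam : seq nat) : {poly int} :=
  \prod_(c : cell lam) qint (hook_length c).

(* Division of integer polynomials by a monic polynomial; [qhook_eq] shows
   that it computes the true quotient whenever there is one. *)
Definition qhook (lam : seq nat) : {poly int} :=
  qfact #|cell lam| %/ qhook_den lam.

Lemma hook_length_gt0 (lam : seq nat) (c : cell lam) : (0 < hook_length c)%N.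
Proof.
by rewrite addn_gt0; apply/orP; left; apply/card_gt0P; exists c;
  rewrite inE eqxx leqnn.
Qed.

Lemma qint_monic d : (0 < d)%N -> qint d \is monic.
Proof.
case: d => // d _; rewrite monicE /qint.
have -> : \sum_(i < d.+1) 'X^i = \poly_(i < d.+1) (1 : int).
  by rewrite poly_def; apply: eq_bigr => i _; rewrite scale1r.
by rewrite lead_coef_poly ?oner_eq0.
Qed.

Lemma qhook_eq (lam : seq nat) (f : {poly int}) :
  f * qhook_den lam = qfact #|cell lam| -> qhook lam = f.
Proof.
move=> fE; rewrite /qhook -fE; apply: Pdiv.IdomainMonic.mulpK.
by apply: monic_prod => c _; apply/qint_monic/hook_length_gt0.
Qed.

Definition exp_2ipi_over (R : realType) (d : nat) : R[i] :=
  Complex (cos (2 * pi / d%:R)) (sin (2 * pi / d%:R)).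

Definition exhibits_CSP (R : realType) (X : finType) (gT : finGroupType)
    (C : {group gT}) (to : {action gT &-> X}) (f : {poly int}) : Prop :=
  [/\ cyclic C,
      f \is a polyOver Num.nneg
    & forall g : gT, g \in C ->
        #|('Fix_to[g])%g|%:R = (map_poly intr f).[exp_2ipi_over R #[g]%g]].

(* Main.v *)
(** Writing an increasing tableau of shape [3 x k] with entries at most [k + 3]
    as [T c = rank c + 1 + b c], where [rank] is the distance to the corner,
    the bits [b] are the indicator of an order filter of [3 x k], and K-promotion
    becomes rowmotion: the new filter is generated by the maximal cells outside
    the old one.  The Stanley-Thomas word turns such a filter into a 3-subset of
    [Z/(k+3)] and rowmotion into rotation by one step; the tableaux that omit a
    value correspond exactly to the [k + 3] cyclic intervals.  With [n = k + 3],
    a nonzero rotation [c] fixes a 3-subset only if [3 c = 0] (add up its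
    elements), and then it fixes [n / 3] of them, none being an interval.
    These counts match the values of [[n+1][n][n-4] / ([2][3])], which is the
    q-hook polynomial, at the roots of unity of order dividing [n]. *)

Require Import Defs.
From mathcomp Require Import all_boot all_order all_fingroup all_algebra all_solvable.
From mathcomp Require Import reals trigo complex zify ring lra.

Set Implicit Arguments.
Unset Strict Implicit.
Unset Printing Implicit Defensive.

Import Order.TTheory GRing.Theory Num.Theory.

(** * Slides on rectangular tableaux with two values per rank *)

Section MinSeq.

Lemma foldr_minn_le v s w : w \in v :: s -> foldr minn v s <= w.
Proof.
elim: s => [|x s IHs] /=; first by rewrite inE => /eqP ->.
rewrite !inE geq_min => /or3P [wv|/eqP->|ws]; rewrite ?leqnn //.
  by rewrite IHs ?inE ?wv ?orbT.
by rewrite IHs ?inE ?ws ?orbT.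
Qed.

Lemma foldr_minn_mem v s : foldr minn v s \in v :: s.
Proof.
elim: s => [|x s IHs] /=; first by rewrite inE.
rewrite /minn; case: ifP => _; rewrite !inE ?eqxx ?orbT //.
by move: IHs; rewrite inE => /orP [] ->; rewrite ?orbT.
Qed.

Lemma min_seqP s v : v \in s -> {in s, forall w, v <= w} -> min_seq s = Some v.
Proof.
case: s => // x s vs vmin /=; congr Some; apply/eqP.
by rewrite eqn_leq foldr_minn_le // vmin // foldr_minn_mem.
Qed.

Variables (lam : seq nat) (U : partial_filling lam) (c : cell lam).

Lemma min_se_labelP d v : se_nbr c d -> U d = Some v ->
  (forall d' w, se_nbr c d' -> U d' = Some w -> v <= w) ->
  min_se_label U c = Some v.
Proof.
move=> cd Ud vmin; apply: min_seqP => [|w]; rewrite mem_pmap.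
  by apply/mapP; exists d; rewrite // mem_filter cd mem_enum.
by case/mapP => d'; rewrite mem_filter => /andP [cd' _] /esym; apply: vmin.
Qed.

Lemma min_se_label_none : (forall d, ~~ se_nbr c d) -> min_se_label U c = None.
Proof.
move=> nc; rewrite /min_se_label (_ : [seq d <- _ | _] = [::]) //.
by rewrite (eq_filter (a2 := pred0)) ?filter_pred0 // => d; apply: negbTE.
Qed.

End MinSeq.

Definition crank lam (c : cell lam) := crow c + ccol c.

Lemma cell_inj lam (c d : cell lam) : crow c = crow d -> ccol c = ccol d -> c = d.
Proof.
case: c => i j; case: d => i' j'; rewrite /crow /ccol /= => /val_inj ii'.
by case: _ / ii' j' => j' /val_inj ->.
Qed.

Lemma se_nbr_crank lam (c d : cell lam) : se_nbr c d -> crank d = (crank c).+1.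
Proof. by rewrite /crank => /orP [] /andP [/eqP -> /eqP ->]; lia. Qed.

Lemma eq_slide (lam : seq nat) (U V : partial_filling lam) :
  U =1 V -> slide U =1 slide V.
Proof.
move=> UV c; have mE d : min_se_label U d = min_se_label V d.
  by rewrite /min_se_label (eq_pmap UV).
rewrite /slide UV mE; case: (V c) => // v; congr (if _ then _ else _).
by apply: eq_existsb => d; rewrite UV mE.
Qed.

Section Rectangle.

Variables a b : nat.
Implicit Type c d : cell (rect a b).

Lemma crow_lt c : crow c < a.
Proof. by apply: leq_trans (ltn_ord (tag c)) _; rewrite size_nseq. Qed.

Lemma ccol_lt c : ccol c < b.
Proof.
apply: leq_trans (ltn_ord (tagged c)) _.
by rewrite nth_nseq -/(crow c) crow_lt.
Qed.

Lemma rect_cell i j : i < a -> j < b -> {c : cell (rect a b) | crow c = i & ccol c = j}.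
Proof.
move=> hi hj; have hi' : i < size (rect a b) by rewrite size_nseq.
have hj' : j < nth 0 (rect a b) i by rewrite nth_nseq hi.
by exists (Tagged (fun i : 'I_(size (rect a b)) => 'I_(nth 0 (rect a b) i))
  (i := Ordinal hi') (Ordinal hj')).
Qed.

Lemma card_rect : #|{: cell (rect a b)}| = a * b.
Proof.
rewrite card_tagged sumnE big_map big_enum /= (eq_bigr (fun=> b)).
  by rewrite sum_nat_const card_ord size_nseq.
move=> i _; rewrite card_ord nth_nseq ifT //.
by apply: leq_trans (ltn_ord i) _; rewrite size_nseq.
Qed.

(** This and [exists_nw] trade quantifiers over neighbours for coordinate inequalities with explicit
    border conditions, a form that [lia] can decide. *)
Lemma forall_se (P : rel nat) c :
  [forall d, se_nbr c d ==> P (crow d) (ccol d)]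
  = (((ccol c).+1 < b) ==> P (crow c) (ccol c).+1)
    && (((crow c).+1 < a) ==> P (crow c).+1 (ccol c)).
Proof.
have [cr cc] := (crow_lt c, ccol_lt c).
apply/forallP/andP => [H|[H1 H2] d]; last first.
  apply/implyP => /orP [] /andP [/eqP dr /eqP dc]; rewrite dr dc.
    by apply: (implyP H1); rewrite -dc ccol_lt.
  by apply: (implyP H2); rewrite -dr crow_lt.
split; apply/implyP => h.
  have [d dr dc] := rect_cell cr h.
  by have /implyP := H d; rewrite /se_nbr dr dc !eqxx; apply.
have [d dr dc] := rect_cell h cc.
by have /implyP := H d; rewrite /se_nbr dr dc !eqxx orbT; apply.
Qed.

Lemma exists_nw (P : rel nat) c :
  [exists d, se_nbr d c && P (crow d) (ccol d)]
  = (0 < ccol c) && P (crow c) (ccol c).-1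
    || (0 < crow c) && P (crow c).-1 (ccol c).
Proof.
have [cr cc] := (crow_lt c, ccol_lt c).
apply/existsP/orP => [[d /andP[/orP[]]]|].
- by case/andP => /eqP -> /eqP ->; left.
- by case/andP => /eqP -> /eqP ->; right.
case=> /andP [h Pc].
  have [|d dr dc] := @rect_cell (crow c) (ccol c).-1 cr; first by lia.
  by exists d; rewrite /se_nbr dr dc Pc prednK // !eqxx.
have [|d dr dc] := @rect_cell (crow c).-1 (ccol c) _ cc; first by lia.
by exists d; rewrite /se_nbr dr dc Pc prednK // !eqxx orbT.
Qed.

Lemma exists_nw_nbr c : 0 < crank c -> exists p, se_nbr p c.
Proof.
rewrite /crank => h; have H := exists_nw (fun _ _ => true) c.
have /existsP [p /andP[pc _]] : [exists p, se_nbr p c && true] by rewrite H; lia.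
by exists p.
Qed.

Lemma exists_se_nbr c : (crank c).+2 < a + b -> exists d, se_nbr c d.
Proof.
have [cr cc] := (crow_lt c, ccol_lt c).
rewrite /crank => h; have H := forall_se (fun _ _ => false) c.
have : ~~ [forall d, se_nbr c d ==> false] by rewrite H !implybF; lia.
by rewrite negb_forall => /existsP [d]; rewrite implybF negbK; exists d.
Qed.

Lemma crank_lt c : (crank c).+2 <= a + b.
Proof. by rewrite /crank; have := crow_lt c; have := ccol_lt c; lia. Qed.

Section Slide.

Variables (T : filling (rect a b) (a + b)) (B B' : pred (cell (rect a b))).
Hypothesis TB : forall c, T c = (crank c).+1 + B c :> nat.
Hypothesis B_mono : forall c d, se_nbr c d -> B c -> B d.
Hypothesis B_corner : forall c, crank c = 0 -> ~~ B c.
(** Rowmotion, recursively in the rank: a cell outside the filter [B] enters [B'] when it is maximal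
    outside [B], and a cell of [B] enters when a northwest neighbour already lies in [B']. *)
Hypothesis B'E : forall c, B' c = [forall d, se_nbr c d ==> B d]
  && (~~ B c || [exists p, se_nbr p c && B' p]).

(** The cells that are empty at some moment. A cell outside [B] has the smallest label of its rank,
    which any empty northwest neighbour takes; a cell of [B] loses its label only to a neighbour
    that sees no smaller one, that is, one in [B']. *)
Let emptied c := ~~ B c || [exists p, se_nbr p c && B' p].

Let no_se c := [forall d, ~~ se_nbr c d].

(* The wave of empty cells reaches rank [t] after [t] slides; behind it every
   label is already final, before the last decrement. *)
Let state t : partial_filling (rect a b) := fun c =>
  if crank c < t then
    if emptied c && no_se c then None else Some ((crank c).+2 + B' c)
  else if (crank c == t) && emptied c then None else Some (T c : nat).

(** The neighbours [d] carry the labels [t.+2 + B d], so the minimum exceeds [t.+2] only when all of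
    them lie in [B], which for an emptied cell is membership in [B']. *)
Lemma state_min t c : crank c = t -> emptied c -> ~~ no_se c ->
  min_se_label (state t) c = Some (t.+2 + B' c).
Proof.
move=> ct ec; rewrite negb_forall => /existsP [d0]; rewrite negbK => cd0.
have stE d : se_nbr c d -> state t d = Some (t.+2 + B d).
  move=> /se_nbr_crank rd; rewrite /state rd ct ltnNge leqnSn /=.
  by rewrite gtn_eqF //= TB rd ct.
have B'c : B' c = [forall d, se_nbr c d ==> B d] by rewrite B'E -/(emptied c) ec andbT.
have [all1|] := boolP [forall d, se_nbr c d ==> B d].
  apply: (min_se_labelP cd0).
    by rewrite stE // B'c all1 (implyP (forallP all1 d0) cd0).
  move=> d w cd; rewrite stE // => -[<-].
  by rewrite B'c all1 (implyP (forallP all1 d) cd).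
move=> nall; rewrite B'c (negbTE nall).
move: nall; rewrite negb_forall => /existsP [d]; rewrite negb_imply => /andP [cd nB].
apply: (min_se_labelP cd); first by rewrite stE // (negbTE nB).
by move=> d' w cd'; rewrite stE // => -[<-]; lia.
Qed.

Lemma state_none t c d : state t c = None -> se_nbr c d -> crank c = t /\ emptied c.
Proof.
move=> + cd; rewrite /state.
case: ifP => [_|_].
  have -> : no_se c = false by apply/negP => /forallP /(_ d); rewrite cd.
  by rewrite andbF.
by case: ifP => // /andP [/eqP -> ->].
Qed.

Lemma slide_state t : slide (state t) =1 state t.+1.
Proof.
move=> c.
(* Empty cells with southeast neighbours all have rank [t], so only cells of rank [t.+1] can lose
   their label in this slide. *)
have no_slide v : crank c != t.+1 -> state t c = Some v -> slide (state t) c = Some v.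
  move=> ct sc; rewrite /slide sc; case: existsP => // -[p /and3P [/eqP sp pc _]].
  have [rp _] := state_none sp pc.
  by move: ct; rewrite (se_nbr_crank pc) rp eqxx.
case: (ltngtP (crank c) t) => ct.
- have stE : state t.+1 c = state t c by rewrite /state ct ltnS (ltnW ct).
  rewrite stE; case sc: (state t c) => [v|].
    by rewrite (no_slide v) //; lia.
  rewrite /slide sc min_se_label_none // => d; apply/negP => cd.
  by have [] := state_none sc cd; lia.
- case: (eqVneq (crank c) t.+1) => ct1; last first.
    have stE s : crank c > s -> state s c = Some (T c : nat).
      by move=> cs; rewrite /state ltnNge (ltnW cs) /= gtn_eqF.
    by rewrite (no_slide (T c)) ?stE //; lia.
  have -> : state t.+1 c = if emptied c then None else Some (T c : nat).
    by rewrite /state ct1 ltnn eqxx.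
  have sc : state t c = Some (T c : nat).
    by rewrite /state ct1 ltnNge leqnSn gtn_eqF.
  rewrite /slide sc; congr (if _ then _ else _).
  have nse p : se_nbr p c -> ~~ no_se p.
    by move=> pc; rewrite negb_forall; apply/existsP; exists c; rewrite pc.
  apply/existsP/idP => [[p /and3P [/eqP sp pc]]|].
    have [rp ep] := state_none sp pc.
    rewrite (state_min rp ep (nse _ pc)) => /eqP [] /eqP.
    rewrite TB ct1 eqn_add2l /emptied.
    case: (B c) => //= B'p; apply/existsP; exists p; rewrite pc.
    by case: (B' p) B'p.
  have witness p : se_nbr p c -> emptied p -> B' p = B c ->
      [&& state t p == None, se_nbr p c & min_se_label (state t) p == Some (T c : nat)].
    move=> pc ep B'p; have rp : crank p = t by have := se_nbr_crank pc; lia.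
    rewrite (state_min rp ep (nse _ pc)) TB ct1 B'p eqxx pc andbT andbT.
    by rewrite /state rp ltnn eqxx ep.
  case Bc: (B c); rewrite /emptied Bc /=.
    case/existsP => p /andP [pc B'p]; exists p; apply: witness; rewrite ?Bc //.
    by move: B'p; rewrite B'E => /andP [].
  (* For [c] outside [B] any northwest neighbour will do: by monotonicity it is outside [B], hence
     empty, and [c] gives it the smaller label. *)
  move=> _; have [|p pc] := @exists_nw_nbr c; first by lia.
  exists p; apply: witness => //.
    by rewrite /emptied; apply/orP; left; apply/negP => /(B_mono pc); rewrite Bc.
  rewrite Bc B'E; apply/negbTE; rewrite negb_and negb_forall; apply/orP; left.
  by apply/existsP; exists c; rewrite pc Bc.
- have -> : state t.+1 c =
      if emptied c && no_se c then None else Some ((crank c).+2 + B' c).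
    by rewrite /state ct ltnSn.
  case ec: (emptied c) => /=; last first.
    have sc : state t c = Some (T c : nat) by rewrite /state ct ltnn eqxx ec.
    rewrite (no_slide (T c)) //; last by lia.
    (* A cell that is never emptied lies in [B] but not in [B'], so its unchanged label already has
       the final form. *)
    move: ec; rewrite /emptied TB => /negbT; rewrite negb_or negbK => /andP [Bc np].
    by rewrite B'E Bc (negbTE np) andbF addn0 addn1.
  have sc : state t c = None by rewrite /state ct ltnn eqxx ec.
  rewrite /slide sc; case: ifPn => nc; last by rewrite state_min ?ct.
  by rewrite min_se_label_none //; apply/forallP.
Qed.

Lemma iter_slide_state t : iter t (@slide _) (delete_ones T) =1 state t.
Proof.
elim: t => [c|t IHt c] /=; last by rewrite (eq_slide IHt) slide_state.
rewrite /delete_ones /state ltn0 TB /emptied; case: (posnP (crank c)) => r0.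
  have Bc := B_corner r0.
  by rewrite r0 Bc (negbTE Bc).
by rewrite ifF //; apply/eqP; lia.
Qed.

Lemma KPro_filter c : KPro T c = (crank c).+1 + B' c :> nat.
Proof.
have [[rc cr] cc] := (crank_lt c, crow_lt c, ccol_lt c).
rewrite ffunE /slide_all iter_slide_state /state card_rect.
(* The number of slides suffices because 1 + i + j is at most (i + 1)(j + 1). *)
have -> : crank c < a * b.
  by apply: leq_trans (leq_mul cr cc); rewrite /crank mulSn mulnS; lia.
case: ifP => [/andP [ec /forallP nc]|_] /=.
  (* The cell left empty is the southeast corner, where [(crank c).+2 = a + b]; its label [m.+1]
     becomes [a + b] after the decrement, which is the value with bit 1. *)
  have b'c : B' c.
    rewrite B'E -/(emptied c) ec andbT; apply/forallP => d.
    by rewrite (negbTE (nc d)).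
  rewrite inordK // b'c; case: (ltnP (crank c).+2 (a + b)) => [|lab]; last by lia.
  by case/exists_se_nbr => d cd; have := nc d; rewrite cd.
by rewrite inordK; case: (B' c); rewrite ?addn1 ?addn0 /=; lia.
Qed.

End Slide.

End Rectangle.

(** * Rowmotion and the Stanley-Thomas word *)

Section StanleyThomas.

Variable k : nat.

Notation rows := (nat * nat * nat)%type.
Implicit Type l : rows.

(* A filter is encoded by the numbers of cells of each row outside it. *)
Definition rowlen l i := nth 0 [:: l.1.1; l.1.2; l.2] i.

Definition staircase l := [&& l.1.1 <= k, l.1.2 <= l.1.1 & l.2 <= l.1.2].

Definition row_filter l (c : cell (rect 3 k)) := rowlen l (crow c) <= ccol c.

Definition rows_tableau l : filling (rect 3 k) (3 + k) :=
  [ffun c => inord ((crank c).+1 + row_filter l c)].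

(** A row with a maximal cell outside the filter starts its new part at that cell, in column
    [l_i - 1]; any other row inherits the start of the row above, and the top row then has all [k]
    cells outside. *)
Definition rowmotion l : rows :=
  let x := if l.1.2 < l.1.1 then l.1.1.-1 else k in
  let y := if l.2 < l.1.2 then l.1.2.-1 else x in
  let z := if 0 < l.2 then l.2.-1 else y in (x, y, z).

(* Row [i] contains a maximal cell outside the filter iff [l_i > l_(i+1)], where
   [l_3 = 0]; the word then records its column [l_i - 1] shifted by [3], and [i]
   itself otherwise. *)
Definition stanley_thomas l : seq nat :=
  [:: if l.1.2 < l.1.1 then l.1.1.+2 else 0;
      if l.2 < l.1.2 then l.1.2.+2 else 1;
      if 0 < l.2 then l.2.+2 else 2].

Definition st_set l : {set 'I_k.+3} := [set i | val i \in stanley_thomas l].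

Definition rot_set n (c : 'I_n.+3) (S : {set 'I_n.+3}) : {set 'I_n.+3} :=
  [set i | (i + c)%R \in S].

Definition cyclic_interval n (u : 'I_n.+3) : {set 'I_n.+3} :=
  [set u; (u + 1)%R; (u + 2)%R].

Lemma staircase_rowmotion l : staircase l -> staircase (rowmotion l).
Proof. by case: l => [[x y] z]; rewrite /staircase /rowmotion /=;
  do ?case: ifPn => ?; lia. Qed.

Lemma val_add1 n (i : 'I_n.+3) : val (i + 1)%R = if i == n.+2 :> nat then 0 else i.+1.
Proof.
rewrite /= [1 %% _]modn_small // addn1; case: eqP => [->|/eqP ni].
  by rewrite modnn.
by rewrite modn_small //; have := ltn_ord i; lia.
Qed.

(** Recorded columns and the defaults 1 and 2 drop by one, while the default 0 turns into [k + 2],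
    which is -1 modulo [k + 3]. Entries may change places in the word, hence the comparison of
    sets. *)
Lemma st_set_rowmotion l : staircase l ->
  st_set (rowmotion l) = rot_set 1%R (st_set l).
Proof.
case: l => [[x y] z]; rewrite /staircase /= => wl.
apply/setP => i; rewrite !inE val_add1 /rowmotion /=; have := ltn_ord i.
case: (ltnP y x) => ?; case: (ltnP z y) => ?; case: (posnP z) => ?;
  by do ?case: ifPn => ?; lia.
Qed.

Lemma stanley_thomas_lt l : staircase l -> all (gtn k.+3) (stanley_thomas l).
Proof. by case: l => [[x y] z]; rewrite /staircase /=; do ?case: ifPn => ?; lia. Qed.

Lemma st_set_inj l l' :
  staircase l -> staircase l' -> st_set l = st_set l' -> l = l'.
Proof.
move=> wl wl' ll'.
have H i : i < k.+3 -> (i \in stanley_thomas l) = (i \in stanley_thomas l').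
  by move=> hi; have /setP /(_ (Ordinal hi)) := ll'; rewrite !inE.
have sub : all [in stanley_thomas l'] (stanley_thomas l).
  apply/allP => i il; suff : i \in stanley_thomas l' by []; rewrite -H //.
  by have /allP := stanley_thomas_lt wl; apply.
have [[h0 h1] h2] := (H 0 isT, H 1 isT, H 2 isT).
move: {H} wl wl' sub h0 h1 h2; rewrite /staircase /stanley_thomas.
case: l {ll'} => [[x y] z]; case: l' => [[x' y'] z'] /=.
rewrite !inE => wl wl' sub h0 h1 h2.
suff: [/\ x = x', y = y' & z = z'] by case=> -> -> ->.
(* Recorded columns are at least 3 after the shift, so membership of 0, 1 and 2 tells which rows
   have a maximal cell outside the filter. The recorded entries decrease strictly, so the inclusion
   [sub] then matches them one by one. *)
have e0 : (y < x) = (y' < x').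
  by move: h0; clear -wl wl'; do ?case: ifPn => ?; lia.
have e1 : (z < y) = (z' < y').
  by move: h1; clear -wl wl'; do ?case: ifPn => ?; lia.
have e2 : (0 < z) = (0 < z').
  by move: h2; clear -wl wl'; do ?case: ifPn => ?; lia.
move: sub; rewrite -e0 -e1 -e2; clear h0 h1 h2.
by case: (ltnP y x) e0 => ?; case: (ltnP z y) e1 => ?;
  case: (posnP z) e2 => ?; split; lia.
Qed.

End StanleyThomas.

Lemma card3_sorted n (S : {set 'I_n}) : #|S| = 3 ->
  exists x y z : 'I_n, [/\ x < y, y < z & S = [set x; y; z]].
Proof.
rewrite cardE => S3.
have : sorted (relpre val ltn) (enum S).
  rewrite /enum_mem; apply: sorted_filter; first by move=> ? ? ?; apply: ltn_trans.
  by rewrite -sorted_map -enumT val_enum_ord iota_ltn_sorted.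
case eS: (enum S) S3 => [|x [|y [|z []]]] // _ /= /and3P [xy yz _].
exists x, y, z; split=> //; apply/setP => i.
by rewrite -mem_enum eS !inE orbA.
Qed.

Section ThreeRowsSurjectivity.

Variable k : nat.

Lemma st_set_surj (S : {set 'I_k.+3}) : #|S| = 3 ->
  exists2 l, staircase k l & st_set k l = S.
Proof.
case/card3_sorted => x [y [z [xy yz ->]]].
suff [l wl H] : exists2 l, staircase k l
    & stanley_thomas l =i [:: x : nat; y : nat; z : nat].
  by exists l => //; apply/setP => i; rewrite inE H !inE orbA.
have zk := ltn_ord z.
move: {x y z} (x : nat) (y : nat) (z : nat) xy yz zk => x y z xy yz zk.
(* Elements above 2 are row lengths plus 2, in decreasing order down the rows; each element at most
   2 names a row that repeats the length below it, or is 0 for the last row. The cases go by the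
   number of elements above 2. *)
pose p := z - 2; pose q := y - 2.
have [hx|hx] := ltnP 2 x.
  exists (p, q, x - 2); rewrite /staircase /p /q /=; first by lia.
  by move=> i; rewrite !inE /=; do ?case: ifPn => ?; lia.
have [hy|hy] := ltnP 2 y.
  exists (if x == 2 then (p, q, 0) else if x == 1 then (p, q, q) else (p, p, q)).
    by rewrite /staircase /p /q; do ?case: ifPn => ?; rewrite /=; lia.
  case: ifPn => ?; last case: ifPn => ?; rewrite /p /q => i; rewrite !inE /=;
  by do ?case: ifPn => ?; lia.
have [hz|hz] := ltnP 2 z.
  exists (if x == 1 then (p, 0, 0) else if y == 1 then (p, p, p) else (p, p, 0)).
    by rewrite /staircase /p; do ?case: ifPn => ?; rewrite /=; lia.
  case: ifPn => ?; last case: ifPn => ?; rewrite /p => i; rewrite !inE /=;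
  by do ?case: ifPn => ?; lia.
by exists (0, 0, 0) => // i; rewrite !inE /=; lia.
Qed.
End ThreeRowsSurjectivity.

Lemma crow3P k (c : cell (rect 3 k)) : [\/ crow c = 0, crow c = 1 | crow c = 2].
Proof. by case: (crow c) (crow_lt c) => [|[|[|]]] // _; constructor. Qed.

(** * Tableaux encoded by row lengths: promotion and omitted values *)

Section RowsTableau.

Variable k : nat.

Implicit Type l : nat * nat * nat.

Lemma card_st_set l : staircase k l -> #|st_set k l| = 3.
Proof.
move=> wl; have /allP lt_k := stanley_thomas_lt wl.
rewrite cardE -(size_map val) (perm_size (s2 := stanley_thomas l)) //.
apply: uniq_perm; first by rewrite (map_inj_uniq val_inj) enum_uniq.
  case: l wl {lt_k} => [[x y] z]; rewrite /staircase /= !inE => wl.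
  by do ?case: ifPn => ?; lia.
move=> i; apply/mapP/idP => [[j]|il]; first by rewrite mem_enum inE => ? ->.
by exists (Ordinal (lt_k _ il)) => //; rewrite mem_enum inE.
Qed.

(* The rows of the only tableau that omits the value [u + 1]. *)
Definition truncated_staircase u : nat * nat * nat :=
  (minn k u, minn k (u - 1), minn k (u - 2)).

Lemma staircase_truncated u : staircase k (truncated_staircase u).
Proof. by rewrite /staircase /=; lia. Qed.

(** Lengths [u], [u - 1], [u - 2] record [u + 2], [u + 1], [u]. Where truncation at 0 or [k] makes
    consecutive lengths equal, the defaults 0, 1, 2 supply the missing elements, including those
    that wrap around. *)
Lemma st_set_truncated (u : 'I_k.+3) :
  st_set k (truncated_staircase u) = cyclic_interval u.
Proof.
apply/setP => i; rewrite !inE -!(inj_eq val_inj).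
rewrite (_ : (u + 2 = u + 1 + 1)%R); last by rewrite -addrA.
rewrite !val_add1 /=.
have := ltn_ord u; have := ltn_ord i.
by do ?[case: ifPn => ? /=]; lia.
Qed.

Lemma rows_tableauE l c :
  rows_tableau k l c = (crank c).+1 + row_filter l c :> nat.
Proof.
rewrite ffunE inordK //; have := crank_lt c.
by case: (row_filter l c); lia.
Qed.

Lemma rowlen_le l i : staircase k l -> rowlen l i <= k.
Proof.
case: l => [[x y] z]; rewrite /staircase /rowlen /= => wl.
by case: i => [|[|[|i]]] /=; rewrite ?nth_nil; lia.
Qed.

Lemma rows_tableau_inj l l' : staircase k l -> staircase k l' ->
  rows_tableau k l = rows_tableau k l' -> l = l'.
Proof.
move=> wl wl' ll'.
have Bll' (c : cell (rect 3 k)) : row_filter l c = row_filter l' c.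
  have := rows_tableauE l c; rewrite ll' rows_tableauE => /addnI.
  by do 2!case: (row_filter _ c).
have le i : i < 3 -> rowlen l i <= rowlen l' i.
  move=> hi; have := rowlen_le i wl'; rewrite leq_eqVlt => /orP [/eqP ->|hj].
    exact: rowlen_le.
  have [c cr cc] := rect_cell hi hj.
  by have := Bll' c; rewrite /row_filter cr cc leqnn.
have ge i : i < 3 -> rowlen l' i <= rowlen l i.
  move=> hi; have := rowlen_le i wl; rewrite leq_eqVlt => /orP [/eqP ->|hj].
    exact: rowlen_le.
  have [c cr cc] := rect_cell hi hj.
  by have := Bll' c; rewrite /row_filter cr cc leqnn.
have E i : i < 3 -> rowlen l i = rowlen l' i.
  by move=> hi; apply/eqP; rewrite eqn_leq le ?ge.
case: l l' E {wl wl' ll' Bll' le ge} => [[x y] z] [[x' y'] z'] E.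
have := E 0 isT; have := E 1 isT; have := E 2 isT.
by rewrite /rowlen /= => -> -> ->.
Qed.

(** The condition [0 < l.1.1] puts the corner outside the filter, so that the entry 1 is present and
    the slides start there. *)
Lemma KPro_rows_tableau l : staircase k l -> 0 < l.1.1 ->
  KPro (rows_tableau k l) = rows_tableau k (rowmotion k l).
Proof.
move=> wl l_gt0; apply/ffunP => c; apply: val_inj.
rewrite [RHS]rows_tableauE; apply: (KPro_filter (B := row_filter l)) => {c}.
- exact: rows_tableauE.
- move=> c d cd; move: cd wl; rewrite /row_filter /staircase.
  case: l l_gt0 => [[x y] z] /= _.
  case/orP => /andP [/eqP -> /eqP ->]; first by lia.
  by case: (crow3P c) => -> /=; rewrite /rowlen /= ?nth_nil; lia.
- move=> c; rewrite /crank /row_filter => /eqP.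
  rewrite addn_eq0 => /andP [/eqP -> /eqP ->].
  by rewrite -ltnNge.
move=> c; rewrite /row_filter.
rewrite (forall_se (fun i j => rowlen l i <= j)).
rewrite (exists_nw (fun i j => rowlen (rowmotion k l) i <= j)).
have := ccol_lt c; move: (ccol c) => j jk.
case: l wl l_gt0 => [[x y] z]; rewrite /staircase /rowmotion /= => wl x_gt0.
case: (crow3P c) => -> /=; rewrite /rowlen /=;
case: (ltnP y x) => ?; case: (ltnP z y) => ?; case: (posnP z) => ? /=; lia.
Qed.

(** The value [u.+1] can only sit at rank [u] outside the filter or at rank [u - 1] inside it.
    Omitting it forces all cells of rank [u] into the filter ([H1]) and all those of rank [u - 1]
    out of it ([H2]), which fixes every row length. *)
Lemma rows_tableau_omits l u : 0 < k -> staircase k l -> u < k.+3 ->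
  (forall c, rows_tableau k l c != u.+1 :> nat) <-> l = truncated_staircase u.
Proof.
move=> k_gt0 wl uk; split=> [H|-> c]; last first.
  have := ccol_lt c; rewrite rows_tableauE /row_filter /crank.
  by case: (crow3P c) => ->; rewrite /rowlen /=; lia.
have H' i j : i < 3 -> j < k -> i + j + (rowlen l i <= j) != u.
  move=> hi hj; have [c cr cc] := rect_cell hi hj.
  by have := H c; rewrite rows_tableauE /row_filter /crank cr cc addSn eqSS.
have H1 i : i < 3 -> i <= u -> u - i < k -> rowlen l i <= u - i.
  move=> hi hu hj; have := H' i _ hi hj.
  by case: (leqP (rowlen l i)) => //; lia.
have H2 i : i < 3 -> i < u -> u - i.+1 < k -> u - i.+1 < rowlen l i.
  move=> hi hu hj; have := H' i _ hi hj.
  by case: (leqP (rowlen l i)) => //; lia.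
move: (H1 0 isT) (H1 1 isT) (H1 2 isT) (H2 0 isT) (H2 1 isT) (H2 2 isT).
case: l wl {H H' H1 H2} => [[x y] z].
rewrite /staircase /rowlen /truncated_staircase /= => wl h1 h2 h3 h4 h5 h6.
by congr (_, _, _); lia.
Qed.
End RowsTableau.

(** * Classification of increasing and packed tableaux *)

Lemma increasing_se lam m (T : filling lam m) c d :
  increasing T -> se_nbr c d -> T c < T d.
Proof.
case/and3P => _ /forallP Tr /forallP Tc /orP [] /andP [/eqP dr /eqP dc].
  by have /forallP /(_ d) /implyP := Tr c; apply; rewrite dr dc eqxx ltnSn.
by have /forallP /(_ d) /implyP := Tc c; apply; rewrite dr dc eqxx ltnSn.
Qed.

Lemma increasing_ge a b m (T : filling (rect a b) m) c :
  increasing T -> crank c < T c.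
Proof.
move=> Tinc; move: {2}(crank c) (erefl (crank c)) => n.
elim: n c => [|n IHn] c cn.
  by rewrite cn; case/and3P: Tinc => /forallP.
have [|p pc] := @exists_nw_nbr a b c; first by rewrite cn.
have pn : crank p = n by have := se_nbr_crank pc; rewrite cn => -[].
by have := increasing_se Tinc pc; have := IHn p pn; rewrite cn pn; lia.
Qed.

(** Entries grow along a path to the southeast corner, of rank [a + b - 2]. With [increasing_ge],
    this leaves just two values per cell when [m = a + b]. *)
Lemma increasing_le a b m (T : filling (rect a b) m) c :
  increasing T -> T c + (a + b) <= m + (crank c).+2.
Proof.
move=> Tinc; move: {2}(a + b - (crank c).+2) (erefl (a + b - (crank c).+2)) => n.
have := crank_lt c.
elim: n c => [|n IHn] c cab cn.
  by have := ltn_ord (T c); lia.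
have [|d cd] := @exists_se_nbr a b c; first by lia.
have dn := se_nbr_crank cd; have := crank_lt d.
by move/IHn => H; have := increasing_se Tinc cd; have := H; rewrite dn; lia.
Qed.

Lemma monotone_threshold (P : pred nat) k :
  (forall j, j.+1 < k -> P j -> P j.+1) ->
  exists2 t, t <= k & forall j, j < k -> P j = (t <= j).
Proof.
(* If [P] holds nowhere below [k], then [find] returns the length [k], a valid threshold. *)
move=> Pm; exists (find P (iota 0 k)); first by rewrite -{2}(size_iota 0 k) find_size.
move=> j jk; case: leqP => [tj|/(before_find 0)]; last by rewrite nth_iota.
have Pt : P (find P (iota 0 k)).
  have tk : find P (iota 0 k) < size (iota 0 k) by rewrite size_iota (leq_ltn_trans tj).
  have := tk; rewrite -has_find => /(nth_find 0).
  by rewrite nth_iota //; move: tk; rewrite size_iota.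
move: tj; elim: j jk => [|j IHj] jk; first by rewrite leqn0 => /eqP <-.
rewrite leq_eqVlt => /orP [/eqP <- //|tj].
by apply: Pm => //; apply: IHj => //; lia.
Qed.

Section IncreasingTableaux.

Variable k : nat.

Implicit Type l : nat * nat * nat.

Lemma increasing_rows_tableau l : staircase k l -> increasing (rows_tableau k l).
Proof.
move=> wl; apply/and3P; split; apply/forallP => c.
- by rewrite rows_tableauE.
- apply/forallP => d; apply/implyP => /andP [/eqP cd lt_cd].
  by rewrite !rows_tableauE /row_filter /crank cd; lia.
apply/forallP => d; apply/implyP => /andP [/eqP cd].
rewrite !rows_tableauE /row_filter /crank cd.
case: l wl => [[x y] z]; rewrite /staircase /= => wl.
by case: (crow3P c) => ->; case: (crow3P d) => ->; rewrite /rowlen /=; lia.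
Qed.

Lemma increasing_rows (T : filling (rect 3 k) (3 + k)) : increasing T ->
  exists2 l, staircase k l & T = rows_tableau k l.
Proof.
move=> Tinc.
pose B (c : cell (rect 3 k)) := T c != (crank c).+1 :> nat.
have TB c : T c = (crank c).+1 + B c :> nat.
  have := increasing_ge c Tinc; have := increasing_le c Tinc.
  by rewrite /B; case: eqP; lia.
(* The bits as a predicate on coordinates, so that each row becomes a monotone predicate on column
   numbers. *)
pose P i j := [exists c : cell (rect 3 k), [&& crow c == i, ccol c == j & B c]].
have PB c : P (crow c) (ccol c) = B c.
  apply/existsP/idP => [[d /and3P [/eqP dr /eqP dc]]|Bc].
    by rewrite (cell_inj dr dc).
  by exists c; rewrite !eqxx.
have B_mono c d : se_nbr c d -> B c -> B d.
  move=> cd; have := increasing_se Tinc cd; rewrite !TB (se_nbr_crank cd).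
  by case: (B c) => //; case: (B d) => //; lia.
have rowP i : i < 3 -> exists2 t, t <= k & forall j, j < k -> P i j = (t <= j).
  move=> hi; apply: monotone_threshold => j jk.
  have [c cr cc] := rect_cell hi (ltnW jk); have [d dr dc] := rect_cell hi jk.
  have := B_mono c d; rewrite -!PB cr cc dr dc; apply.
  by rewrite /se_nbr dr dc cr cc !eqxx.
have colP i j : i.+1 < 3 -> j < k -> P i j -> P i.+1 j.
  move=> hi jk.
  have [c cr cc] := rect_cell (ltnW hi) jk; have [d dr dc] := rect_cell hi jk.
  have := B_mono c d; rewrite -!PB cr cc dr dc; apply.
  by rewrite /se_nbr dr dc cr cc !eqxx orbT.
have [x xk xP] := rowP 0 isT; have [y yk yP] := rowP 1 isT.
have [z zk zP] := rowP 2 isT.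
have yx : y <= x.
  rewrite leqNgt; apply/negP => xy; have xk' : x < k by lia.
  by have := colP 0 x isT xk'; rewrite xP // yP // leqnn => /(_ isT); lia.
have zy : z <= y.
  rewrite leqNgt; apply/negP => yz; have yk' : y < k by lia.
  by have := colP 1 y isT yk'; rewrite yP // zP // leqnn => /(_ isT); lia.
exists (x, y, z); first by rewrite /staircase /=; lia.
apply/ffunP => c; apply: val_inj; rewrite [RHS]rows_tableauE [LHS]TB -PB /row_filter.
have ck := ccol_lt c.
by case: (crow3P c) => ->; rewrite /rowlen /= ?xP ?yP ?zP.
Qed.

Lemma packed_maxE (T : filling (rect 3 k) (3 + k)) :
  packed T && (max_entry T == 3 + k)
  = [forall u : 'I_k.+3, exists c, T c == u.+1 :> nat].
Proof.
apply/andP/forallP => [[/allP Tp /eqP Tm] u|H].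
  by apply: Tp; rewrite Tm mem_iota; have := ltn_ord u; lia.
have Tm : max_entry T = 3 + k.
  apply/eqP; rewrite eqn_leq; apply/andP; split.
    by apply/bigmax_leqP => c _; rewrite -ltnS ltn_ord.
  have /existsP [c /eqP Tc] := H ord_max.
  by apply: leq_trans (leq_bigmax c); rewrite Tc.
split; last by rewrite Tm.
apply/allP => v; rewrite Tm mem_iota => /andP [v0 vk].
have vk' : v.-1 < k.+3 by lia.
by have := H (Ordinal vk'); rewrite /= prednK.
Qed.

(** A non-packed tableau omits some [u.+1], so its rows are [truncated_staircase u]; injectivity of
    [st_set] carries this over to the interval at [u]. *)
Lemma inc_packed_rows_tableau l : 0 < k -> staircase k l ->
  [&& increasing (rows_tableau k l), packed (rows_tableau k l)
    & max_entry (rows_tableau k l) == 3 + k]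
  = [forall u, st_set k l != cyclic_interval u].
Proof.
move=> k_gt0 wl; rewrite increasing_rows_tableau // packed_maxE.
apply: eq_forallb => u; rewrite -st_set_truncated.
apply/existsP/idP => [[c /eqP Tc]|ne].
  apply/negP => /eqP E; have := st_set_inj wl (staircase_truncated k u) E.
  by case/(rows_tableau_omits k_gt0 wl (ltn_ord u))/(_ c)/eqP.
apply/existsP; apply: contraNT ne; rewrite negb_exists => /forallP H.
by apply/eqP; congr st_set; apply/(rows_tableau_omits k_gt0 wl (ltn_ord u)).
Qed.

End IncreasingTableaux.

(** * Rotation of 3-subsets *)

Section Rotation.

Variable k : nat.
Implicit Types (S : {set 'I_k.+3}) (c x u v : 'I_k.+3).

Local Open Scope ring_scope.

Lemma rot_set_add c d S : rot_set c (rot_set d S) = rot_set (c + d) S.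
Proof. by apply/setP => i; rewrite !inE addrA. Qed.

Lemma rot_set0 S : rot_set 0 S = S.
Proof. by apply/setP => i; rewrite !inE addr0. Qed.

Lemma card_rot_set c S : #|rot_set c S| = #|S|.
Proof.
rewrite -(card_imset _ (addIr c)); apply: eq_card => i; apply/imsetP/idP.
  by case=> j; rewrite inE => jS ->.
by move=> iS; exists (i - c); rewrite ?inE subrK.
Qed.

Lemma rot_set_interval c u : rot_set c (cyclic_interval u) = cyclic_interval (u - c).
Proof.
apply/setP => i; rewrite !inE.
by rewrite ![_ - c + _]addrAC ![in RHS](eq_sym i) ![in RHS]subr_eq ![_ == i + c]eq_sym.
Qed.

Lemma natr_ord_neq0 j : (0 < j < k.+3)%N -> (j%:R : 'I_k.+3) != 0.
Proof.
move=> /andP [j0 jk]; rewrite -(inj_eq val_inj) /= Zp_nat /= modn_small //.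
by rewrite -lt0n.
Qed.

(** Each of [u], [v] lies in the interval of the other. If they differ, two steps of size 1 or 2
    lead from [u] back to [u], so 2, 3 or 4 vanishes modulo [k + 3], which is at least 5. *)
Lemma cyclic_interval_inj : (2 <= k)%N -> injective (@cyclic_interval k).
Proof.
move=> k2 u v uv.
have : u \in cyclic_interval v by rewrite -uv !inE eqxx.
have : v \in cyclic_interval u by rewrite uv !inE eqxx.
have ne j : (0 < j < 5)%N -> (j%:R : 'I_k.+3) <> 0.
  by move=> jk; apply/eqP/natr_ord_neq0; lia.
rewrite !inE -!orbA => /or3P [/eqP -> //|/eqP E1|/eqP E1] /or3P [/eqP //|/eqP E2|/eqP E2].
- by case: (ne 2) => //; apply: (addrI u); rewrite addr0 {2}E2 E1; ring.
- by case: (ne 3) => //; apply: (addrI u); rewrite addr0 {2}E2 E1; ring.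
- by case: (ne 3) => //; apply: (addrI u); rewrite addr0 {2}E2 E1; ring.
- by case: (ne 4) => //; apply: (addrI u); rewrite addr0 {2}E2 E1; ring.
Qed.

Definition non_interval_triples : {set {set 'I_k.+3}} :=
  [set S : {set 'I_k.+3} | (#|S| == 3%N) && [forall u, S != cyclic_interval u]].

Lemma card_cyclic_interval u : #|cyclic_interval u| = 3%N.
Proof. by rewrite -st_set_truncated card_st_set // staircase_truncated. Qed.

Lemma card_non_interval_triples : (2 <= k)%N ->
  (#|non_interval_triples| + k.+3)%N = 'C(k.+3, 3)%N.
Proof.
move=> k2; have <- : #|[set S : {set 'I_k.+3} | #|S| == 3%N]| = 'C(k.+3, 3)%N.
  by rewrite card_draws card_ord.
rewrite -(cardsID ((@cyclic_interval k) @: setT)) addnC; congr (_ + _)%N.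
  rewrite (setIidPr _).
    by rewrite card_imset ?cardsT ?card_ord //; apply: cyclic_interval_inj.
  by apply/subsetP => S /imsetP [u _ ->]; rewrite inE card_cyclic_interval.
apply: eq_card => S; rewrite !inE andbC; congr andb.
apply/forallP/negP => [H /imsetP [u _ E]|H u].
  by have := H u; rewrite E eqxx.
by apply/eqP => E; apply: H; rewrite E imset_f.
Qed.

(* Compare the sums of the elements of [S] and of its rotation. *)
Lemma card_rot_fixed c S : rot_set c S = S -> c *+ #|S| = 0.
Proof.
move=> cS; apply: (addrI (\sum_(i in S) i)); rewrite addr0.
rewrite -sumr_const -big_split /= [RHS](reindex_inj (addIr c)) /=.
by apply: eq_bigl => i; rewrite -{1}cS inE.
Qed.

Section Order3.

Variable c : 'I_k.+3.
Hypotheses (c_neq0 : c != 0) (c3 : c *+ 3 = 0).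

Let orb x : {set 'I_k.+3} := [set x; x + c; x + c *+ 2].
Let fixed : {set {set 'I_k.+3}} :=
  [set S : {set 'I_k.+3} | (#|S| == 3%N) && (rot_set c S == S)].

Lemma card_orb x : #|orb x| = 3%N.
Proof.
have c2 : c *+ 2 != 0.
  by apply: contraNneq c_neq0 => c20; move: c3; rewrite mulrS c20 addr0 => ->.
have e1 : (x + c *+ 2 == x) = false.
  by rewrite -subr_eq0 [x + _]addrC addrK (negbTE c2).
have e2 : (x + c *+ 2 == x + c) = false.
  by rewrite (inj_eq (addrI x)) mulr2n -subr_eq0 addrK (negbTE c_neq0).
have e3 : (x == x + c) = false.
  by rewrite eq_sym -subr_eq0 [x + _]addrC addrK (negbTE c_neq0).
by rewrite /orb setUC cardsU1 cards2 !inE e1 e2 e3.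
Qed.

Lemma rot_orb x : rot_set c (orb x) = orb x.
Proof.
apply/setP => i; rewrite !inE mulr2n !addrA !(inj_eq (addIr c)).
rewrite (_ : (i + c == x) = (i == x + c + c)); first by rewrite -orbA orbC.
have e : x + c + c + c = x by rewrite -!addrA -[c + (c + c)]/(c *+ 3) c3 addr0.
by rewrite -[RHS](inj_eq (addIr c)) e.
Qed.

Lemma fixed_orb S x : S \in fixed -> x \in S -> S = orb x.
Proof.
rewrite inE => /andP [/eqP S3 /eqP cS] xS.
have cS' y : y \in S -> y + c \in S by rewrite -{1}cS inE.
apply/esym/eqP; rewrite eqEcard card_orb S3 leqnn andbT.
apply/subsetP => y; rewrite !inE mulr2n addrA -orbA => /or3P [] /eqP -> //.
  exact: cS'.
exact/cS'/cS'.
Qed.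

(** The fixed triples are the cosets of the subgroup generated by [c], of order 3, and they
    partition the group. *)
Lemma card_fixed : (#|fixed| * 3)%N = k.+3.
Proof.
rewrite -[RHS]card_ord -cardsT; apply/esym/card_uniform_partition.
  by move=> S; rewrite inE => /andP [/eqP].
have orbF x : orb x \in fixed by rewrite inE card_orb rot_orb !eqxx.
apply/and3P; split.
- apply/eqP/setP => x; rewrite inE; apply/bigcupP; exists (orb x) => //.
  by rewrite !inE eqxx.
- apply/trivIsetP => A B AF BF; apply: contraR => /pred0Pn [x /= /andP [xA xB]].
  by rewrite (fixed_orb AF xA) (fixed_orb BF xB).
by rewrite inE cards0.
Qed.

End Order3.

Lemma card_fixed_triples c : (2 <= k)%N -> c != 0 ->
  (#|[set S in non_interval_triples | rot_set c S == S]| * 3)%N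
  = if c *+ 3 == 0 then k.+3 else 0%N.
Proof.
move=> k2 c0; case: eqP => [c3|c3].
  rewrite -[RHS](card_fixed c0 c3); congr (_ * 3)%N; apply: eq_card => S.
  rewrite !inE -andbA; congr andb; case: eqP => [cS|]; last by rewrite andbF.
  rewrite andbT; apply/forallP => u; apply/eqP => Su.
  have SF : S \in [set S : {set 'I_k.+3} | (#|S| == 3%N) && (rot_set c S == S)].
    by rewrite inE cS eqxx Su card_cyclic_interval.
  have uS : u \in S by rewrite Su !inE eqxx.
  (* If an interval were a coset of the subgroup, then 1 would be [c] or [c *+ 2], and 3 would
     vanish modulo [k + 3]. *)
  have : u + 1 \in cyclic_interval u by rewrite !inE eqxx orbT.
  rewrite -Su (fixed_orb c0 c3 SF uS) !inE -{2}(addr0 u) !(inj_eq (addrI u)).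
  have n3 : (3%:R : 'I_k.+3) != 0 by apply: natr_ord_neq0; lia.
  rewrite oner_eq0 /= => /orP [] /eqP E; case/eqP: n3; rewrite E.
    exact: c3.
  by rewrite -mulrnA mulnC mulrnA c3 mul0rn.
apply/eqP; rewrite muln_eq0 orbF cards_eq0; apply/eqP/setP => S; rewrite !inE.
apply/negbTE/negP => /andP [/andP [/eqP S3 _] /eqP cS].
by apply: c3; rewrite -S3; apply: card_rot_fixed.
Qed.

End Rotation.

(** * The q-hook polynomial *)

Lemma big_cell (R : Type) (idx : R) (op : Monoid.com_law idx) lam (F : nat -> nat -> R) :
  \big[op/idx]_(c : cell lam) F (crow c) (ccol c)
  = \big[op/idx]_(0 <= i < size lam) \big[op/idx]_(0 <= j < nth 0 lam i) F i j.
Proof.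
rewrite big_mkord; under [RHS]eq_bigr => i _ do rewrite big_mkord.
by rewrite (sig_big_dep _ (fun i _ => true) (fun i j => F (val i) (val j))).
Qed.

Lemma card_cell lam : #|{: cell lam}| = sumn lam.
Proof.
rewrite -sum1_card (big_cell _ _ (fun _ _ => 1)) sumnE [RHS](big_nth 0).
by apply: eq_bigr => i _; rewrite sum_nat_const_nat muln1 subn0.
Qed.

Lemma sum_nat_geq m n : \sum_(0 <= j < n) (m <= j) = n - m.
Proof. by elim: n => [|n IHn]; rewrite ?big_nil // big_nat_recr //= IHn; lia. Qed.

Lemma sum_nat_eq_mul m n (G : nat -> nat) :
  \sum_(0 <= j < n) (j == m) * G j = (m < n) * G m.
Proof.
elim: n => [|n IHn]; rewrite ?big_nil // big_nat_recr //= IHn.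
by case: (ltngtP m n) => [mn|mn|->]; rewrite ?mul0n ?ltnS ?(ltnW mn) ?ltnn ?leqnn; lia.
Qed.

Lemma hook_lengthE lam (c : cell lam) :
  hook_length c = (nth 0 lam (crow c) - ccol c)
    + \sum_(0 <= i < size lam) (crow c < i) * (ccol c < nth 0 lam i).
Proof.
have cardE' (P : pred (cell lam)) : #|[set d | P d]| = \sum_d (P d : nat).
  by rewrite -sum1dep_card big_mkcond; apply: eq_bigr => d _; case: (P d).
rewrite /hook_length !cardE'; congr addn.
  rewrite (big_cell _ _ (fun i j => ((i == crow c) && (ccol c <= j) : nat))).
  under eq_bigr => i _.
    under eq_bigr => j _ do rewrite -mulnb.
    rewrite -big_distrr /= sum_nat_geq; over.
  by rewrite sum_nat_eq_mul ltn_ord mul1n.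
rewrite (big_cell _ _ (fun i j => ((j == ccol c) && (crow c < i) : nat))).
apply: eq_bigr => i _; under eq_bigr => j _ do rewrite -mulnb.
by rewrite (sum_nat_eq_mul _ _ (fun _ => crow c < i : nat)) mulnC.
Qed.

Section QHook.

Local Open Scope ring_scope.

(** In the three long rows the hooks are t + 4, t + 3, t + 2 in the first column and 3, 2, 1 in the
    second; the short rows contribute t, ..., 1. *)
Lemma qhook_den_two_columns t :
  qhook_den (nseq 3 2%N ++ nseq t 1%N)
  = qint 3 * qint 2 * qint t.+4 * qint t.+3 * qint t.+2 * qfact t.
Proof.
set lam := nseq 3 2%N ++ nseq t 1%N.
pose H i j :=
  ((nth 0 lam i - j) + \sum_(0 <= i' < size lam) (i < i') * (j < nth 0 lam i'))%N.
have -> : qhook_den lam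
    = \prod_(0 <= i < size lam) \prod_(0 <= j < nth 0%N lam i) qint (H i j).
  rewrite -[RHS](big_cell _ _ (fun i j => qint (H i j))).
  by apply: eq_bigr => c _; rewrite hook_lengthE.
have slam : size lam = t.+3 by rewrite size_cat !size_nseq.
have lamE i : (i < t.+3)%N -> nth 0%N lam i = if (i < 3)%N then 2%N else 1%N.
  by case: i => [|[|[|i]]] // it; rewrite /lam /= nth_nseq (_ : i < t)%N.
have H0 i : (i < t.+3)%N -> H i 0%N = (nth 0 lam i + (t.+2 - i))%N.
  move=> it; rewrite /H subn0 slam; congr addn.
  rewrite -[RHS]/(t.+3 - i.+1)%N -sum_nat_geq; apply: eq_big_nat => i' /andP [_ it'].
  by rewrite lamE //; case: ifP; rewrite muln1.
have H1 i : (i < 3)%N -> H i 1%N = (3 - i)%N.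
  move=> i3; rewrite /H slam; have -> : nth 0%N lam i = 2%N by rewrite lamE ?i3 //; lia.
  have -> : (\sum_(0 <= i' < t.+3) (i < i') * (1 < nth 0 lam i') = 2 - i)%N; last by lia.
  rewrite (big_cat_nat (n := 3)) //= [X in (_ + X)%N]big1_seq ?addn0.
    by rewrite !big_nat_recr //= big_nil; case: i i3 => [|[|[|]]].
  move=> i' /andP [_]; rewrite mem_index_iota => /andP [i'3 i't].
  by rewrite lamE // (ltnNge i' 3) i'3 muln0.
have row2 i : (i < 3)%N ->
    \prod_(0 <= j < nth 0%N lam i) qint (H i j) = qint (t.+4 - i) * qint (3 - i).
  move=> i3; have it : (i < t.+3)%N by lia.
  rewrite lamE // i3 big_ltn // big_nat1 H0 // H1 // lamE // i3; congr (qint _ * _).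
  by lia.
have row1 i : (3 <= i < t.+3)%N ->
    \prod_(0 <= j < nth 0%N lam i) qint (H i j) = qint (t.+3 - i).
  move=> /andP [i3 it].
  rewrite lamE // (ltnNge i 3) i3 big_nat1 H0 // lamE // (ltnNge i 3) i3; congr qint.
  by rewrite /=; lia.
rewrite slam big_ltn // row2 // big_ltn // row2 // big_ltn // row2 //.
rewrite (eq_big_nat _ _ row1).
have -> : \prod_(3 <= i < t.+3) qint (t.+3 - i) = qfact t.
  rewrite /qfact big_nat_rev /= !big_add1 /=; apply: eq_big_nat => i it.
  by congr qint; lia.
have -> : qint (3 - 2) = 1 by rewrite /qint big_ord1.
by rewrite !subSS !subn0 mulr1; ring.
Qed.

Lemma qint_split a b : qint (a + b) = qint a + 'X^a * qint b.
Proof.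
rewrite /qint big_split_ord /= mulr_sumr; congr (_ + _).
by apply: eq_bigr => i _; rewrite exprD.
Qed.

Lemma qintS n : qint n.+1 = qint n + 'X^n.
Proof. by rewrite /qint big_ord_recr. Qed.

(** The q-integer of [a] with q replaced by q^p, which is the quotient of [qint (p * a)] by
    [qint p]. *)
Definition qint_step (p a : nat) : {poly int} := \sum_(i < a) 'X^(p * i).

Lemma qint_mul p a : qint (p * a) = qint p * qint_step p a.
Proof.
elim: a => [|a IHa]; first by rewrite muln0 /qint /qint_step !big_ord0 mulr0.
by rewrite mulnS addnC qint_split IHa /qint_step big_ord_recr /= mulrDr ['X^_ * _]mulrC.
Qed.

Definition nneg_coef (p : {poly int}) := forall i, 0 <= p`_i.

Lemma nneg_coefP p : nneg_coef p -> p \is a polyOver Num.nneg.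
Proof. by move=> p0; apply/(all_nthP 0) => i _; apply: p0. Qed.

Lemma nneg_coefXn n : nneg_coef 'X^n.
Proof. by move=> i; rewrite coefXn. Qed.

Lemma nneg_coefD p q : nneg_coef p -> nneg_coef q -> nneg_coef (p + q).
Proof. by move=> p0 q0 i; rewrite coefD addr_ge0. Qed.

Lemma nneg_coefM p q : nneg_coef p -> nneg_coef q -> nneg_coef (p * q).
Proof. by move=> p0 q0 i; rewrite coefM sumr_ge0 // => j _; rewrite mulr_ge0. Qed.

Lemma nneg_coef_qint n : nneg_coef (qint n).
Proof. by move=> i; rewrite coef_sum sumr_ge0 // => j _; apply: nneg_coefXn. Qed.

Lemma nneg_coef_qint_step p n : nneg_coef (qint_step p n).
Proof. by move=> i; rewrite coef_sum sumr_ge0 // => j _; apply: nneg_coefXn. Qed.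

Lemma qint2E : qint 2 = 1 + 'X.
Proof. by rewrite /qint !big_ord_recr big_ord0 /= add0r. Qed.

Lemma qint3E : qint 3 = 1 + 'X + 'X^2.
Proof. by rewrite /qint !big_ord_recr big_ord0 /= add0r. Qed.

Lemma qint6E : qint 6 = (1 - 'X + 'X^2) * (qint 2 * qint 3).
Proof. by rewrite qint2E qint3E /qint !big_ord_recr big_ord0 /=; ring. Qed.

(** Multiplying by [1 - 'X] telescopes to [1 - 'X^(n.+3)], and the negative term cancels against one
    from ['X^2 * qint n.+3]. *)
Lemma nneg_coef_cyclotomic6 n : nneg_coef ((1 - 'X + 'X^2) * qint n.+3).
Proof.
rewrite (_ : _ * _ = 1 + 'X^2 * qint n.+1 + 'X^(n.+4)); last first.
  rewrite mulrDl mulrC qintE !(qintS n.+2) (qintS n.+1).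
  rewrite !exprS; ring.
apply: nneg_coefD (nneg_coefXn _).
by apply: nneg_coefD (nneg_coefXn 0) (nneg_coefM (nneg_coefXn 2) (nneg_coef_qint _)).
Qed.

(** By the residue of [t] modulo 6, either two different factors absorb [qint 2] and [qint 3]
    ([step23]), or one factor is divisible by [qint 6] ([step6]). In the latter case the sixth
    cyclotomic polynomial is left over, and a further factor restores nonnegativity. *)
Lemma qhook_quotient t : exists2 f : {poly int}, nneg_coef f
  & f * (qint 2 * qint 3) = qint t.+1 * (qint t.+1.+4 * qint t.+2.+4).
Proof.
have step23 x y z a b : x = (2 * a)%N -> y = (3 * b)%N ->
    exists2 f, nneg_coef f & f * (qint 2 * qint 3) = qint z * (qint x * qint y).
  move=> -> ->; exists (qint z * (qint_step 2 a * qint_step 3 b)).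
    apply: nneg_coefM (nneg_coef_qint _) _.
    exact: nneg_coefM (nneg_coef_qint_step _ _) (nneg_coef_qint_step _ _).
  by rewrite !qint_mul; ring.
have step6 x y z a : x = (6 * a)%N -> (2 < y)%N ->
    exists2 f, nneg_coef f & f * (qint 2 * qint 3) = qint z * (qint x * qint y).
  move=> -> y2; exists (qint z * (qint_step 6 a * ((1 - 'X + 'X^2) * qint y))).
    apply: nneg_coefM (nneg_coef_qint _) _.
    apply: nneg_coefM (nneg_coef_qint_step _ _) _.
    by rewrite (_ : y = (y - 3).+3); [exact: nneg_coef_cyclotomic6|lia].
  by rewrite qint_mul qint6E; ring.
have tE := divn_eq t 6; have := ltn_mod t 6; rewrite /=.
move: tE; set c := (t %/ 6)%N; set r := (t %% 6)%N => tE r6.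
have [r0|r0] := eqVneq r 0%N.
  rewrite [qint t.+1.+4 * _]mulrC; apply: (step6 _ _ _ c.+1); lia.
have [r1|r1] := eqVneq r 1%N.
  apply: (step6 _ _ _ c.+1); lia.
have [r2|r2] := eqVneq r 2%N.
  rewrite mulrCA [qint t.+1 * _]mulrC.
  apply: (step23 _ _ _ (3 * c + 4)%N (2 * c + 1)%N); lia.
have [r3|r3] := eqVneq r 3%N.
  apply: (step23 _ _ _ (3 * c + 4)%N (2 * c + 3)%N); lia.
have [r4|r4] := eqVneq r 4%N.
  rewrite [qint t.+1.+4 * _]mulrC; apply: (step23 _ _ _ (3 * c + 5)%N (2 * c + 3)%N); lia.
rewrite mulrA [_ * qint t.+2.+4]mulrC [qint t.+1 * _]mulrC.
by apply: (step23 _ _ _ (3 * c + 5)%N (2 * c + 2)%N); lia.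
Qed.

Lemma qfact_addn m t : qfact (m + t) = qfact t * \prod_(0 <= i < m) qint (t + i).+1.
Proof.
elim: m => [|m IHm]; first by rewrite big_nil mulr1.
by rewrite big_nat_recr //= mulrA -IHm addSn /qfact [in LHS]big_nat_recr //= addnC.
Qed.

(** The shape has [t + 6] cells; in the q-hook quotient [qfact t] and the q-integers of t + 2, t +
    3, t + 4 cancel. *)
Lemma qhook_two_columns t f :
  f * (qint 2 * qint 3) = qint t.+1 * (qint t.+1.+4 * qint t.+2.+4) ->
  qhook (nseq 3 2%N ++ nseq t 1%N) = f.
Proof.
move=> fE; apply: qhook_eq; rewrite qhook_den_two_columns card_cell sumn_cat !sumn_nseq.
rewrite mul1n -[(2 * 3)%N]/6%N qfact_addn !big_nat_recr //= big_nil.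
rewrite !addnS addn0 mul1r.
transitivity (f * (qint 2 * qint 3) * (qint t.+4 * qint t.+3 * qint t.+2 * qfact t)).
  by ring.
by rewrite fE; ring.
Qed.

End QHook.

(** * Values of the q-hook polynomial at roots of unity *)

Section Evaluation.

Local Open Scope ring_scope.

Variables (C : numFieldType) (z : C).

Let ev (p : {poly int}) := (map_poly intr p).[z].

Lemma evM p q : ev (p * q) = ev p * ev q.
Proof. by rewrite /ev rmorphM /= hornerM. Qed.

Lemma ev_qint d : ev (qint d) = \sum_(i < d) z ^+ i.
Proof.
rewrite /ev /qint rmorph_sum /= horner_sum; apply: eq_bigr => i _.
by rewrite map_polyXn hornerXn.
Qed.

Lemma ev_qint_step p a : z ^+ p = 1 -> ev (qint_step p a) = a%:R.
Proof.
move=> zp; rewrite /ev /qint_step rmorph_sum /= horner_sum.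
under eq_bigr => i _ do rewrite map_polyXn hornerXn exprM zp expr1n.
by rewrite sumr_const card_ord.
Qed.

Lemma ev_qint_mod p a b : ev (qint p) = 0 -> z ^+ p = 1 ->
  ev (qint (p * a + b)) = ev (qint b).
Proof.
move=> p0 zp; rewrite qint_split qint_mul.
rewrite /ev rmorphD /= hornerD !rmorphM /= !hornerM -/(ev (qint p)) p0 mul0r add0r.
by rewrite map_polyXn hornerXn exprM zp expr1n mul1r.
Qed.

Lemma qint_neq0 d : (0 < d)%N -> qint d != 0.
Proof. by move=> d0; apply/monic_neq0/qint_monic. Qed.

Variables (t : nat) (f : {poly int}).
Hypothesis fE : f * (qint 2 * qint 3) = qint t.+1 * (qint t.+1.+4 * qint t.+2.+4).

Lemma ev_quotient_one : z = 1 -> ev f * 6%:R = (t.+1 * (t.+1.+4 * t.+2.+4))%:R.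
Proof.
have e1 d : z = 1 -> ev (qint d) = d%:R.
  move=> z1; rewrite ev_qint (eq_bigr (fun=> 1)) ?sumr_const ?card_ord //.
  by move=> i _; rewrite z1 expr1n.
move=> z1; have := congr1 ev fE; rewrite !evM !e1 // -!natrM => <-.
by [].
Qed.

Lemma ev_quotient_generic : z ^+ t.+1.+4 = 1 -> z != 1 ->
  1 + z != 0 -> 1 + z + z ^+ 2 != 0 -> ev f = 0.
Proof.
move=> zn z1 z2 z3; have := congr1 ev fE; rewrite !evM.
have -> : ev (qint t.+1.+4) = 0.
  apply: (mulfI (x := z - 1)); first by rewrite subr_eq0.
  by rewrite ev_qint -subrX1 zn subrr mulr0.
have -> : ev (qint 2) = 1 + z by rewrite ev_qint !big_ord_recr big_ord0 /= add0r.
have -> : ev (qint 3) = 1 + z + z ^+ 2 by rewrite ev_qint !big_ord_recr big_ord0 /= add0r.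
rewrite mul0r mulr0 => /eqP; rewrite !mulf_eq0 (negbTE z2) (negbTE z3) !orbF.
by move/eqP.
Qed.

(** As [qint 2] vanishes at -1, it is first cancelled, as a polynomial, against [qint t.+1.+4]. The
    factor [qint t.+1] still vanishes, since [t.+1] is even. *)
Lemma ev_quotient_two : z = - 1 -> (2 %| t.+1.+4)%N -> ev f = 0.
Proof.
move=> z1 /dvdnP [a aE].
have fE2 : f * qint 3 = qint t.+1 * (qint_step 2 a * qint t.+2.+4).
  apply: (mulIf (qint_neq0 (isT : 0 < 2)%N)).
  rewrite -mulrA [qint 3 * _]mulrC fE aE mulnC qint_mul; ring.
have q2 : ev (qint 2) = 0 by rewrite ev_qint !big_ord_recr big_ord0 /= add0r z1 subrr.
have q3 : ev (qint 3) = 1.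
  by rewrite ev_qint !big_ord_recr big_ord0 /= add0r z1 subrr add0r sqrrN expr1n.
have := congr1 ev fE2; rewrite !evM q3 mulr1 => ->.
rewrite (_ : t.+1 = 2 * (a - 2) + 0)%N; last by lia.
rewrite ev_qint_mod // ?z1 ?sqrrN ?expr1n //.
by rewrite ev_qint big_ord0 mul0r.
Qed.

(** Cancelling [qint 3] against [qint t.+1.+4 = qint (3 * a)] leaves the value [a]. Modulo 3 the
    other two indices are 2 and 1, so they contribute [1 + z], which cancels with [qint 2], and
    1. *)
Lemma ev_quotient_three : 1 + z + z ^+ 2 = 0 -> 1 + z != 0 -> (3 %| t.+1.+4)%N ->
  ev f * 3%:R = t.+1.+4%:R.
Proof.
move=> z0 z1 /dvdnP [a aE].
have zz : z ^+ 3 = 1.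
  by apply/eqP; rewrite -subr_eq0 subrX1 !big_ord_recr big_ord0 /= add0r z0 mulr0.
have fE2 : f * qint 2 = qint t.+1 * (qint_step 3 a * qint t.+2.+4).
  apply: (mulIf (qint_neq0 (isT : 0 < 3)%N)).
  rewrite -mulrA fE aE mulnC qint_mul; ring.
have q3 : ev (qint 3) = 0 by rewrite ev_qint !big_ord_recr big_ord0 /= add0r.
have q2 : ev (qint 2) = 1 + z by rewrite ev_qint !big_ord_recr big_ord0 /= add0r.
have := congr1 ev fE2; rewrite !evM ev_qint_step //.
rewrite (_ : t.+1 = 3 * (a - 2) + 2)%N; last by lia.
rewrite (_ : (3 * (a - 2) + 2).+1.+4 = 3 * a + 1)%N; last by lia.
rewrite !ev_qint_mod // q2 [ev (qint 1)]ev_qint big_ord1 mulr1 [_ * a%:R]mulrC.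
move=> /(mulIf z1) ->; rewrite -natrM; congr _%:R; lia.
Qed.

End Evaluation.

(** * The complex numbers exp(2 pi i / d) *)

Section RootOfUnity.

Local Open Scope ring_scope.

Variable R : realType.

Lemma exp_2ipi_over_exp d : (0 < d)%N -> exp_2ipi_over R d ^+ d = 1.
Proof.
move=> d0; have demoivre (x : R) m :
    (Complex (cos x) (sin x) : R[i]) ^+ m = Complex (cos (x *+ m)) (sin (x *+ m)).
  elim: m => [|m IHm]; first by rewrite mulr0n cos0 sin0.
  rewrite exprS IHm mulrS cosD sinD -[LHS]/(Complex _ _); congr Complex.
  by rewrite addrC mulrC [X in _ + X]mulrC.
rewrite /exp_2ipi_over demoivre -[_ / _ *+ d]mulr_natr mulfVK ?pnatr_eq0 -?lt0n //.
by rewrite mulr_natl cos2pi sin2pi.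
Qed.

Lemma exp_2ipi_over1 : exp_2ipi_over R 1 = 1.
Proof. by have := @exp_2ipi_over_exp 1 isT; rewrite expr1. Qed.

Lemma exp_2ipi_over2 : exp_2ipi_over R 2 = -1.
Proof.
rewrite /exp_2ipi_over mulrAC divff ?pnatr_eq0 // mul1r cospi sinpi.
by rewrite -[RHS]/(Complex _ _) oppr0.
Qed.

Lemma sin_2pi_over_gt0 d : (2 < d)%N -> 0 < sin (2 * pi / d%:R : R).
Proof.
move=> d2; apply: sin_gt0_pi; have pi0 := @pi_gt0 R.
have d0 : 0 < d%:R :> R by rewrite ltr0n; lia.
have d2' : 2 < d%:R :> R by rewrite ltr_nat.
apply/andP; split; first by rewrite divr_gt0 // mulr_gt0.
by rewrite ltr_pdivrMr // mulrC ltr_pM2l.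
Qed.

Lemma exp_2ipi_over_neq d (a : R) : (2 < d)%N -> Complex a 0 + exp_2ipi_over R d != 0.
Proof.
move=> /sin_2pi_over_gt0 s0; rewrite eq_complex /= add0r negb_and.
by rewrite (gt_eqF s0) orbT.
Qed.

Lemma exp_2ipi_over3 : 1 + exp_2ipi_over R 3 + exp_2ipi_over R 3 ^+ 2 = 0.
Proof.
set w := exp_2ipi_over R 3; have w1 : w - 1 != 0.
  rewrite addrC (_ : - 1 = Complex (-1) 0 :> R[i]) ?exp_2ipi_over_neq //.
  by rewrite -[LHS]/(Complex _ _) oppr0.
apply: (mulfI w1); rewrite mulr0.
have := subrX1 w 3; rewrite !big_ord_recr big_ord0 /= add0r => <-.
by rewrite exp_2ipi_over_exp // subrr.
Qed.

(** With cosine c and sine s, the imaginary part is s(1 + 2c), which is positive because the angle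
    is at most pi / 2. *)
Lemma exp_2ipi_over_neq3 d : (3 < d)%N ->
  1 + exp_2ipi_over R d + exp_2ipi_over R d ^+ 2 != 0.
Proof.
move=> d3; have s0 := @sin_2pi_over_gt0 d (ltnW d3).
have c0 : 0 <= cos (2 * pi / d%:R : R).
  apply: cos_ge0_pihalf; have pi0 := @pi_gt0 R.
  have d0 : 0 < d%:R :> R by rewrite ltr0n; lia.
  have d4 : 4 <= d%:R :> R by rewrite ler_nat.
  apply/andP; split.
    by rewrite (@le_trans _ _ 0) // ?oppr_le0 ?divr_ge0 ?mulr_ge0 // ltW.
  by rewrite ler_pdivrMr //; nra.
rewrite /exp_2ipi_over; set c := cos _ in c0 *; set s := sin _ in s0 *.
rewrite eq_complex /= negb_and; apply/orP; right.
by rewrite gt_eqF //; nra.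
Qed.

End RootOfUnity.

(** * Promotion and cyclic sieving *)

Section Promotion.

Variable k : nat.
Hypothesis k_ge2 : 2 <= k.

Let X := inc_packed (rect 3 k) (3 + k).
Let k_gt0 : 0 < k := ltnW k_ge2.

Lemma inc_packed_rows (T : X) :
  exists l, staircase k l && (val T == rows_tableau k l).
Proof.
have /and3P [/increasing_rows [l wl Tl] _ _] := valP T.
by exists l; rewrite wl Tl eqxx.
Qed.

(** The choice is harmless: [rows_tableau_inj] makes the staircase unique. *)
Definition tableau_rows (T : X) := xchoose (inc_packed_rows T).

Definition tableau_triple (T : X) := st_set k (tableau_rows T).

Lemma tableau_rowsP T :
  staircase k (tableau_rows T) /\ val T = rows_tableau k (tableau_rows T).
Proof. by have /andP [wl /eqP] := xchooseP (inc_packed_rows T). Qed.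

Lemma tableau_triple_inj : injective tableau_triple.
Proof.
move=> T T'; have [wl Tl] := tableau_rowsP T; have [wl' Tl'] := tableau_rowsP T'.
by move/(st_set_inj wl wl') => ll'; apply: val_inj; rewrite Tl Tl' ll'.
Qed.

Lemma tableau_triple_mem T : tableau_triple T \in non_interval_triples k.
Proof.
have [wl Tl] := tableau_rowsP T.
rewrite inE card_st_set // eqxx -inc_packed_rows_tableau // -Tl.
exact: (valP T).
Qed.

Lemma tableau_tripleP l : staircase k l -> st_set k l \in non_interval_triples k ->
  {T : X | val T = rows_tableau k l & tableau_triple T = st_set k l}.
Proof.
move=> wl; rewrite inE -inc_packed_rows_tableau // => /andP [_ Tl].
exists (exist _ (rows_tableau k l) Tl) => //.
rewrite /tableau_triple; set T := exist _ _ _; have [wl' Tl'] := tableau_rowsP T.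
by rewrite -(rows_tableau_inj wl wl' Tl').
Qed.

Lemma tableau_triple_surj S : S \in non_interval_triples k ->
  exists T, tableau_triple T = S.
Proof.
move=> SY; have := SY; rewrite inE => /andP [/eqP /st_set_surj [l wl lS] _].
by rewrite -lS in SY *; have [T _ TS] := tableau_tripleP wl SY; exists T.
Qed.

Lemma rot_set_non_interval c S :
  S \in non_interval_triples k -> rot_set c S \in non_interval_triples k.
Proof.
rewrite !inE card_rot_set => /andP [-> /forallP H] /=; apply/forallP => u.
apply: contra (H (u + c)%R) => /eqP E; apply/eqP.
have := congr1 (rot_set (- c)%R) E; rewrite rot_set_add addNr rot_set0 => ->.
by rewrite rot_set_interval opprK.
Qed.

Lemma KPro_tableau (T : X) : {T' : X | val T' = KPro (val T)
  & tableau_triple T' = rot_set 1%R (tableau_triple T)}.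
Proof.
have [wl Tl] := tableau_rowsP T; have TY := tableau_triple_mem T.
rewrite /tableau_triple in TY *; rewrite Tl.
(* Otherwise all row lengths are 0 and the triple is the interval at 0: a packed tableau must
   contain the entry 1. *)
have l0 : 0 < (tableau_rows T).1.1.
  rewrite lt0n; apply/negP => /eqP l0.
  move: TY; rewrite inE => /andP [_ /forallP /(_ 0%R)].
  rewrite -st_set_truncated /truncated_staircase /= !minn0.
  case: (tableau_rows T) wl l0 => [[x y] z]; rewrite /staircase /= => wl x0.
  by rewrite (_ : (x, y, z) = (0, 0, 0)) ?eqxx //; congr (_, _, _); lia.
have := tableau_tripleP (staircase_rowmotion wl).
rewrite st_set_rowmotion // => /(_ (rot_set_non_interval 1%R TY)) [T' T'l T'S].
by exists T'; rewrite // T'l KPro_rows_tableau.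
Qed.

Definition promote (T : X) : X := s2val (KPro_tableau T).

Lemma tableau_triple_promote T :
  tableau_triple (promote T) = rot_set 1%R (tableau_triple T).
Proof. exact: (s2valP' (KPro_tableau T)). Qed.

Lemma rot_set_inj n (c : 'I_n.+3) : injective (rot_set c).
Proof.
move=> S S' /(congr1 (rot_set (- c)%R)).
by rewrite !rot_set_add addNr !rot_set0.
Qed.

Lemma promote_inj : injective promote.
Proof.
move=> T T' /(congr1 tableau_triple); rewrite !tableau_triple_promote.
by move=> /rot_set_inj /tableau_triple_inj.
Qed.

Definition kpro : {perm X} := perm promote_inj.

Lemma val_kpro T : val (kpro T) = KPro (val T).
Proof. by rewrite permE; apply: (s2valP (KPro_tableau T)). Qed.

Lemma val_kproX j T : val ((kpro ^+ j)%g T) = iter j (@KPro (rect 3 k) (3 + k)) (val T).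
Proof.
elim: j => [|j IHj]; first by rewrite expg0 perm1.
by rewrite expgSr permM val_kpro IHj.
Qed.

Lemma tableau_triple_kproX j T :
  tableau_triple ((kpro ^+ j)%g T) = rot_set j%:R%R (tableau_triple T).
Proof.
elim: j => [|j IHj]; first by rewrite expg0 perm1 rot_set0.
by rewrite expgSr permM permE tableau_triple_promote IHj rot_set_add mulrS.
Qed.

Lemma card_inc_packed : #|X| = #|non_interval_triples k|.
Proof.
rewrite -cardsT -(card_imset _ tableau_triple_inj); apply: eq_card => S.
apply/imsetP/idP => [[T _ ->]|/tableau_triple_surj [T <-]]; last by exists T.
exact: tableau_triple_mem.
Qed.

Lemma card_fix_kproX j : #|[set T | (kpro ^+ j)%g T == T]|
  = #|[set S in non_interval_triples k | rot_set j%:R%R S == S]|.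
Proof.
rewrite -(card_imset _ tableau_triple_inj); apply: eq_card => S.
have fixE T : ((kpro ^+ j)%g T == T)
    = (rot_set j%:R%R (tableau_triple T) == tableau_triple T).
  by rewrite -tableau_triple_kproX (inj_eq tableau_triple_inj).
rewrite inE; apply/imsetP/andP => [[T]|[/tableau_triple_surj [T <-]]].
  by rewrite inE fixE => TS ->; rewrite tableau_triple_mem.
by rewrite -fixE => TF; exists T; rewrite ?inE.
Qed.

(** With n = k + 3, the difference C(n, 3) - n equals n(n - 4)(n + 1) / 6. *)
Lemma card_inc_packed_mul6 : #|X| * 6 = k.-1 * (k.+3 * k.+4).
Proof.
have := card_non_interval_triples k_ge2; rewrite -card_inc_packed.
have : 'C(k.+3, 3) * 6 = k.+3 * k.+2 * k.+1.
  by rewrite -[6]/(3`!) bin_ffact !ffactnS ffactn0 /= muln1 mulnA.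
by case: k k_ge2 => // k' _ /=; nia.
Qed.

(** The action is faithful: a nonzero rotation fixing everything would make [#|X| * 3] equal to
    [k.+3] or 0, too small for the count of [X]. *)
Lemma kproX_eq1 j : ((kpro ^+ j)%g == 1%g) = (j%:R == 0 :> 'I_k.+3)%R.
Proof.
apply/eqP/eqP => [j1|j0]; last first.
  apply/permP => T; apply: tableau_triple_inj.
  by rewrite tableau_triple_kproX j0 rot_set0 perm1.
apply/eqP/negPn/negP => j0.
have := card_fixed_triples k_ge2 j0; rewrite -card_fix_kproX j1.
have -> : #|[set T : X | (1 : {perm X})%g T == T]| = #|X|.
  by apply: eq_card => T; rewrite !inE perm1 eqxx.
have := card_inc_packed_mul6.
case: ifP => _; case: k k_ge2 => // k' ? /=; nia.
Qed.

Lemma kpro_expg : (kpro ^+ k.+3)%g = 1%g.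
Proof.
by apply/eqP; rewrite kproX_eq1 Zp_nat; apply/eqP/val_inj; apply: modnn.
Qed.

End Promotion.

Theorem theorem1p2 (R : realType) (k : nat) (hk : (2 <= k)%N) :
  (exists kpro : {perm inc_packed (rect 3 k) (3 + k)},
     (forall T : inc_packed (rect 3 k) (3 + k), val (kpro T) = KPro (val T))
     /\ exhibits_CSP R (<[kpro]>)%G ('P)%act (qhook (nseq 3 2 ++ nseq (k - 2) 1)))
  /\ (forall T : inc_packed (rect 3 k) (3 + k),
        iter (3 + k) (@KPro (rect 3 k) (3 + k)) (val T) = val T).
Proof.
split; last first.
  by move=> T; rewrite -(val_kproX hk) (kpro_expg hk) perm1.
exists (kpro hk); split; first exact: val_kpro.
(* With t = k - 2 and n = k + 3, the indices t + 1, t + 5, t + 6 are n - 4, n, n + 1. *)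
have [f f0 fE] := qhook_quotient (k - 2).
rewrite (qhook_two_columns fE).
have e1 : (k - 2).+1 = k.-1 by lia.
have e2 : (k - 2).+1.+4 = k.+3 by lia.
have e3 : (k - 2).+2.+4 = k.+4 by lia.
split; [exact: cycle_cyclic | exact: nneg_coefP |].
move=> g /cycleP [j ->]; set d := #[_]%g.
rewrite (_ : #|afix _ _| = #|[set T | (kpro hk ^+ j)%g T == T]|); last first.
  by apply: eq_card => T; rewrite [RHS]inE; apply/afix1P/eqP.
have n3E : (3%:R : R[i])%R != 0%R by rewrite pnatr_eq0.
have d_gt0 : 0 < d := order_gt0 _.
have d_dvd : d %| k.+3.
  by rewrite order_dvdn -expgM mulnC expgM kpro_expg expg1n.
have d3 : (d %| 3) = ((j%:R *+ 3)%R == 0 :> 'I_k.+3)%R.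
  by rewrite order_dvdn -expgM kproX_eq1 natrM mulr_natr.
(* For the identity both sides count [X]. A nontrivial rotation has fixed triples only when its
   order [d] divides 3, that is d = 3; for d = 2 and d > 3 both sides vanish. *)
have [j0|j0] := eqVneq (j%:R : 'I_k.+3)%R 0%R.
  have g1 : (kpro hk ^+ j)%g = 1%g by apply/eqP; rewrite kproX_eq1 j0.
  have -> : d = 1%N by rewrite /d g1 order1.
  have n6 : (6%:R : R[i])%R != 0%R by rewrite pnatr_eq0.
  apply: (mulIf n6); rewrite (ev_quotient_one fE) ?exp_2ipi_over1 //.
  rewrite -natrM e3 e2 e1 -card_inc_packed_mul6 //; congr (_ * _)%:R%R.
  by apply: eq_card => T; rewrite !inE g1 perm1 eqxx.
have := card_fixed_triples hk j0; rewrite -(card_fix_kproX hk) -d3 => cardF.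
apply: (mulIf n3E); rewrite -natrM cardF.
have d1 : d != 1%N by rewrite order_eq1 kproX_eq1.
have zn : (exp_2ipi_over R d ^+ (k - 2).+1.+4 = 1)%R.
  rewrite e2; case/dvdnP: d_dvd => q ->.
  by rewrite mulnC exprM exp_2ipi_over_exp // expr1n.
have [d2|d2] := eqVneq d 2.
  rewrite d2 /= (ev_quotient_two fE) ?mul0r ?exp_2ipi_over2 // e2.
  by rewrite -d2.
have d2' : 2 < d by lia.
have z2 : (1 + exp_2ipi_over R d != 0)%R by apply: (exp_2ipi_over_neq 1).
have [d3'|d3'] := eqVneq d 3.
  rewrite d3' dvdnn in d3 *; rewrite (ev_quotient_three fE) ?exp_2ipi_over3 ?e2 //.
    by rewrite -d3'.
  by rewrite -d3'.
rewrite (ev_quotient_generic fE) ?exp_2ipi_over_neq3 ?mul0r //; last by lia.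
  by rewrite (_ : (d %| 3) = false) //; apply/negbTE; rewrite gtnNdvd //; lia.
(* The root differs from 1 since its imaginary part is nonzero; -1 is written as a complex pair to
   fit [exp_2ipi_over_neq]. *)
rewrite -subr_eq0 addrC (_ : (- 1 : R[i])%R = Complex (-1)%R 0%R).
  exact: exp_2ipi_over_neq.
by rewrite -[LHS]/(Complex _ _) oppr0.
Qed.
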